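(* Let $D\subseteq{}^*\mathbb N$ be an infinite hyperfinite set and $U\subseteq{}^*\mathbb N$ an additive countably cofinal cut. Then $\mathsf F_D\not\le_{\mathrm{CD}}\mathsf E_U$.
   Context: Work in a fixed countably saturated nonstandard universe; ${}^*\mathbb N$ = hyperintegers, $\mathbb N$ = standard ones. A set is countably determined (CD) if it equals $\bigcup_{f\in F}\bigcap_{m\in\mathbb N}X_{f\restriction m}$ for some $F\subseteq2^{\mathbb N}$ and internal $X_s$ ($s$ finite binary sequences) with $X_t\subseteq X_s$ for $s\subset t$; a map is CD if its graph is. For equivalence relations $E$ on $X$, $F$ on $Y$: $E\le_{\mathrm{CD}}F$ means there is a CD map $\vartheta:X\to Y$ with $x\mathrel Ex'\iff\vartheta(x)\mathrel F\vartheta(x')$. A cut is an initial segment of ${}^*\mathbb N$, additive if closed under $+$, countably cofinal if $U=\bigcup_n[0,a_n)$ for a strictly increasing $(a_n)_{n\in\mathbb N}$ in ${}^*\mathbb N$. $\mathsf E_U$ is the equivalence relation on ${}^*\mathbb N$: $x\mathrel{\mathsf E_U}y\iff|x-y|\in U$. $\mathsf F_D$ is the equivalence relation on the set of internal maps $\xi:D\to\{0,1\}$ given by $\xi\mathrel{\mathsf F_D}\eta$ iff $\{d\in D:\xi(d)\ne\eta(d)\}$ is finite. *)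

(* Defs.v *)
From mathcomp Require Import all_boot.
From mathcomp Require Import boolp classical_sets functions cardinality.

Set Implicit Arguments.
Unset Strict Implicit.
Unset Printing Implicit Defensive.

Local Open Scope classical_set_scope.

(** The stages V_0 = X, V_{n+1} = V_n `|` P(V_n) of the superstructure over a
    set X of atoms, relative to a carrier C. *)
Definition non_atom (X C : Type) (atom : X -> C) (a : C) : Prop :=
  forall x, a <> atom x.

Fixpoint stage (X C : Type) (atom : X -> C) (elem : C -> C -> Prop) (n : nat)
    : set C :=
  if n is m.+1 then
    [set a | stage atom elem m a \/
             (non_atom atom a /\ forall b, elem b a -> stage atom elem m b)]
  else range atom.

(** The superstructure V(X) = \bigcup_n V_n. The fields determine it up to
    isomorphism over X; [compr n P] is the set {a in V_n | P a}, so every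
    subset of every stage is an element of V(X). *)
Record superstructure (X : Type) := Superstructure {
  car :> Type;
  atom : X -> car;
  elem : car -> car -> Prop;
  compr : nat -> set car -> car;
  atom_inj : forall x y, atom x = atom y -> x = y;
  atom_empty : forall x a, ~ elem a (atom x);
  elem_ext : forall a b, non_atom atom a -> non_atom atom b ->
    (forall x, elem x a <-> elem x b) -> a = b;
  stage_ex : forall a, exists n, stage atom elem n a;
  compr_set : forall n P, non_atom atom (compr n P);
  elem_compr : forall n P a, elem a (compr n P) <-> stage atom elem n a /\ P a
}.

Arguments atom {X} s _.
Arguments elem {X s} _ _.
Arguments compr {X} s _ _.

Definition is_set (X : Type) (V : superstructure X) (a : V) : Prop :=
  non_atom (atom V) a.

Definition elts (X : Type) (V : superstructure X) (a : V) : set V :=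
  [set x | elem x a].

(** Kuratowski pairs, relationally: [is_pair p a b] means p = {{a}, {a, b}}. *)
Definition is_upair (X : Type) (V : superstructure X) (c a b : V) : Prop :=
  is_set c /\ forall x, elem x c <-> x = a \/ x = b.

Definition is_pair (X : Type) (V : superstructure X) (p a b : V) : Prop :=
  exists u v, [/\ is_upair u a a, is_upair v a b & is_upair p u v].

(** Bounded formulas of the language {=, \in}, with de Bruijn indices:
    [BAll j phi] is "for all x in v_j, phi", where x becomes variable 0. *)
Inductive bformula :=
  | BEq of nat & nat
  | BMem of nat & nat
  | BNot of bformula
  | BAnd of bformula & bformula
  | BAll of nat & bformula.

Definition scons (T : Type) (x : T) (e : nat -> T) (n : nat) : T :=
  if n is m.+1 then e m else x.

Fixpoint holds (X : Type) (V : superstructure X) (e : nat -> V)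
    (phi : bformula) : Prop :=
  match phi with
  | BEq i j => e i = e j
  | BMem i j => elem (e i) (e j)
  | BNot p => ~ holds e p
  | BAnd p q => holds e p /\ holds e q
  | BAll j p => forall x, elem x (e j) -> holds (scons x e) p
  end.

Definition internal_in (X Y : Type) (V : superstructure X)
    (W : superstructure Y) (star : V -> W) (a : W) : Prop :=
  exists A : V, elem a (star A).

(** A countably saturated nonstandard universe: a bounded elementary embedding
    star : V(X) -> V(Y) with star X = Y, for which every countable family of
    internal sets with the finite intersection property has a common element.
    The natural numbers are atoms (they are not required to be all of X). *)
Record nonstandard_universe := NonstandardUniverse {
  std_atoms : Type;
  ns_atoms : Type;
  std : superstructure std_atoms;
  ns : superstructure ns_atoms;
  nat_atom : nat -> std_atoms;
  nat_atom_inj : injective nat_atom;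
  star : std -> ns;
  star_base : star (compr std 0 setT) = compr ns 0 setT;
  transfer : forall (phi : bformula) (e : nat -> std),
    holds e phi <-> holds (star \o e) phi;
  saturation : forall A : nat -> ns,
    (forall n, is_set (A n) /\ internal_in star (A n)) ->
    (forall n, exists x, forall k, k <= n -> elem x (A k)) ->
    exists x, forall n, elem x (A n)
}.

Arguments nat_atom {n} _.
Arguments star {n} _.

Section Notions.
Variable W : nonstandard_universe.
Implicit Types (D x y z d xi eta : ns W) (U P : set (ns W)).

Definition internal (a : ns W) : Prop := internal_in (@star W) a.

Definition nat_elt (n : nat) : std W := atom (std W) (nat_atom n).

(** The set N, and the set of all finite subsets of N. *)
Definition natS : std W := compr (std W) 0 (range nat_elt).

Definition finsubS : std W :=
  compr (std W) 1
    [set A | [/\ is_set A, elts A `<=` range nat_elt & finite_set (elts A)]].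

(** A pair of atoms lies in V_2 and a triple ((a, b), c) of atoms in V_4. *)
Definition relS (R : nat -> nat -> Prop) : std W :=
  compr (std W) 2 [set p | exists m n, R m n /\ is_pair p (nat_elt m) (nat_elt n)].

Definition opS (f : nat -> nat -> nat) : std W :=
  compr (std W) 4
    [set t | exists m n p,
       is_pair p (nat_elt m) (nat_elt n) /\ is_pair t p (nat_elt (f m n))].

Definition hypernat : set (ns W) := elts (star natS).

(** The extensions of R and f to hypernatural numbers; [hop f x y z] means
    z = f(x, y). *)
Definition hrel (R : nat -> nat -> Prop) x y : Prop :=
  exists p, is_pair p x y /\ elem p (star (relS R)).

Definition hop (f : nat -> nat -> nat) x y z : Prop :=
  exists p t, [/\ is_pair p x y, is_pair t p z & elem t (star (opS f))].

Definition hle := hrel (fun m n => m <= n).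
Definition hlt := hrel (fun m n => m < n).
Definition hadd := hop addn.
(** |x - y|, by truncated subtraction on standard numbers. *)
Definition hdist := hop (fun m n => (m - n) + (n - m)).

Definition cut U : Prop :=
  U `<=` hypernat /\ forall x y, U y -> hle x y -> U x.

Definition additive U : Prop :=
  forall x y z, U x -> U y -> hadd x y z -> U z.

Definition countably_cofinal U : Prop :=
  exists a : nat -> ns W,
    [/\ forall n, hypernat (a n),
        forall n, hlt (a n) (a n.+1)
      & U = \bigcup_n [set x | hlt x (a n)]].

Definition hyperfinite D : Prop := elem D (star finsubS).

(** [F] is a set of infinite binary sequences, [mkseq f m] is f restricted to
    {0, ..., m-1}. *)
Definition countably_determined P : Prop :=
  exists (F : set (nat -> bool)) (A : seq bool -> ns W),
    [/\ forall s, is_set (A s) /\ internal (A s),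
        forall s t, prefix s t -> elts (A t) `<=` elts (A s)
      & P = \bigcup_(f in F) \bigcap_m elts (A (mkseq f m))].

Definition graph (S : set (ns W)) (theta : ns W -> ns W) : set (ns W) :=
  [set p | exists2 x, S x & is_pair p x (theta x)].

(** Only the values of theta on S matter. *)
Definition CD_reducible (S : set (ns W)) (E : ns W -> ns W -> Prop)
    (T : set (ns W)) (F : ns W -> ns W -> Prop) : Prop :=
  exists theta : ns W -> ns W,
    [/\ forall x, S x -> T (theta x),
        countably_determined (graph S theta)
      & forall x x', S x -> S x' -> (E x x' <-> F (theta x) (theta x'))].

Definition E_cut U x y : Prop := exists2 u, U u & hdist x y u.

Definition value xi d (b : ns W) : Prop := exists2 p, is_pair p d b & elem p xi.

Definition bit (b : ns W) : Prop :=
  b = star (nat_elt 0) \/ b = star (nat_elt 1).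

Definition internal_maps D : set (ns W) :=
  [set xi | [/\ internal xi, is_set xi,
      forall p, elem p xi -> exists d b, [/\ elem d D, bit b & is_pair p d b]
    & forall d, elem d D -> exists! b, value xi d b]].

Definition F_fin D xi eta : Prop :=
  finite_set [set d | elem d D /\
    exists a b, [/\ value xi d a, value eta d b & a <> b]].

End Notions.

Arguments hypernat : clear implicits.

(* Main.v *)
Require Import Defs.
From mathcomp Require Import all_boot.
From mathcomp Require Import boolp classical_sets functions cardinality.
From mathcomp Require Import filter zify.

(** Suppose [theta] is a countably determined reduction, with graph
    \bigcup_(f in F) \bigcap_m A_(f|m), and fix distinct points d_0, d_1, ...
    of D. A nonprincipal ultrafilter on nat picks a limit type of the
    characteristic functions chi_c of the finite sets {d_i : i in c}, the type
    of x being the set of those s for which A_s has a point above x. By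
    saturation this type is realized, so there is f in F such that for every m
    the set B_m = A_(f|m) has points above all vertices of cubes {chi_c} of
    arbitrarily large finite dimension, two adjacent vertices of which differ
    at two points of D. By saturation there is k such that points of B_k above
    such neighbours have second coordinates closer than a_k. Going from one
    vertex of a cube to the opposite one and back, a discrete intermediate value
    argument yields two antipodal vertices whose second coordinates are at
    distance at most 2 a_k, which is in U. Saturating once more gives two maps
    that differ at infinitely many points and have E_U-equivalent images. *)

Set Implicit Arguments.
Unset Strict Implicit.
Unset Printing Implicit Defensive.

Local Open Scope classical_set_scope.

(** * Superstructures and bounded formulas *)

Section Superstructure.
Variables (X : Type) (V : superstructure X).
Implicit Types (a b c p x : V).

Definition atoms : V := compr V 0 setT.

Lemma is_setE a : is_set a <-> ~ elem a atoms.
Proof.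
rewrite elem_compr /is_set /non_atom /=; split.
  by move=> na [[x _ xa] _]; exact: na (esym xa).
by move=> na x xa; apply: na; split=> //; exists x.
Qed.

Lemma stage_mono m n a : m <= n ->
  stage (atom V) (@elem X V) m a -> stage (atom V) (@elem X V) n a.
Proof.
elim: n m a => [|n IH] m a; first by rewrite leqn0 => /eqP ->.
rewrite leq_eqVlt => /orP[/eqP -> //|mn h]; left; exact: IH h.
Qed.

Lemma stage_elem n a x : stage (atom V) (@elem X V) n a -> elem x a ->
  stage (atom V) (@elem X V) n x.
Proof.
elim: n a => [|n IH] a; first by move=> [y _ <-] xa; case: (atom_empty xa).
by move=> [sa|[_ sa]] xa; left; [exact: IH xa|exact: sa].
Qed.

Lemma stage_set n a : is_set a ->
  (forall x, elem x a -> stage (atom V) (@elem X V) n x) ->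
  stage (atom V) (@elem X V) n.+1 a.
Proof. by move=> sa ha; right. Qed.

Lemma upair_ex n a b : stage (atom V) (@elem X V) n a ->
  stage (atom V) (@elem X V) n b ->
  exists2 c, is_upair c a b & stage (atom V) (@elem X V) n.+1 c.
Proof.
move=> sa sb; exists (compr V n [set x | x = a \/ x = b]).
  split; first exact: compr_set.
  move=> x; rewrite elem_compr; split=> [[]//|h]; split=> //.
  by case: h => ->.
apply: stage_set; first exact: compr_set.
by move=> x; rewrite elem_compr => -[].
Qed.

Lemma pair_ex n a b : stage (atom V) (@elem X V) n a ->
  stage (atom V) (@elem X V) n b ->
  exists2 p, is_pair p a b & stage (atom V) (@elem X V) n.+2 p.
Proof.
move=> sa sb.
have [u hu su] := upair_ex sa sa; have [v hv sv] := upair_ex sa sb.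
by have [p hp sp] := upair_ex su sv; exists p => //; exists u, v.
Qed.

Lemma is_pair_ex a b : exists p, is_pair p a b.
Proof.
have [m sa] := stage_ex a; have [n sb] := stage_ex b.
have [p hp _] := pair_ex (stage_mono (leq_maxl m n) sa)
  (stage_mono (leq_maxr m n) sb).
by exists p.
Qed.

Lemma upair_uniq a b c c' : is_upair c a b -> is_upair c' a b -> c = c'.
Proof.
move=> [sc hc] [sc' hc']; apply: elem_ext => // x.
by rewrite hc hc'.
Qed.

Lemma is_pair_uniq p q a b : is_pair p a b -> is_pair q a b -> p = q.
Proof.
move=> [u [v [hu hv hp]]] [u' [v' [hu' hv' hq]]].
move: hp; rewrite (upair_uniq hu hu') (upair_uniq hv hv') => hp.
exact: upair_uniq hp hq.
Qed.

Lemma elem_upair c a b x : is_upair c a b -> elem x c <-> x = a \/ x = b.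
Proof. by case. Qed.

Lemma upair_inj c a b b' : is_upair c a b -> is_upair c a b' -> b = b'.
Proof.
move=> [_ h] [_ h'].
have [e|e] : b = a \/ b = b' by apply/h'/h; right.
  by rewrite e; have [->|->] : b' = a \/ b' = b by apply/h/h'; right.
exact: e.
Qed.

Lemma is_pair_inj p a b a' b' : is_pair p a b -> is_pair p a' b' ->
  a = a' /\ b = b'.
Proof.
move=> [u [v [hu hv hp]]] [u' [v' [hu' hv' hp']]].
have aa : a = a'.
  have : u = u' \/ u = v' by apply/(elem_upair _ hp')/(elem_upair _ hp); left.
  case=> e.
    have : a = a' \/ a = a'.
      by apply/(elem_upair _ hu'); rewrite -e; apply/(elem_upair _ hu); left.
    by case.
  have : a' = a \/ a' = a.
    by apply/(elem_upair _ hu); rewrite e; apply/(elem_upair _ hv'); left.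
  by case.
split=> //; subst a'.
have uu := upair_uniq hu hu'; subst u'.
have vv := upair_inj hp hp'; subst v'.
exact: upair_inj hv hv'.
Qed.
End Superstructure.

Arguments atoms {X} V.

(** * Bounded formulas and their meaning *)

Section Formulas.

Definition FOr p q := BNot (BAnd (BNot p) (BNot q)).
Definition FImp p q := BNot (BAnd p (BNot q)).
Definition FIff p q := BAnd (FImp p q) (FImp q p).
Definition FEx j p := BNot (BAll j (BNot p)).

(* In the formulas below, [b] is the index of a variable that stands for the
   set of atoms: it is needed to say in the bounded language that an object is
   a set. *)
Definition FSet b x := BNot (BMem x b).

Definition FUpair b c x y :=
  BAnd (FSet b c) (BAnd (BMem x c) (BAnd (BMem y c)
    (BAll c (FOr (BEq 0 x.+1) (BEq 0 y.+1))))).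

(** The members {x} and {x, y} of a Kuratowski pair belong to it, so the pair itself bounds both
    quantifiers. In [FOp] the inner pair is reached through a member of the outer one. *)
Definition FPair b p x y :=
  FEx p (FEx p.+1 (BAnd (FUpair b.+2 1 x.+2 x.+2)
    (BAnd (FUpair b.+2 0 x.+2 y.+2) (FUpair b.+2 p.+2 1 0)))).

Definition FRel b r x y := FEx r (FPair b.+1 0 x.+1 y.+1).

Definition FOp b o x y z :=
  FEx o (FEx 0 (FEx 0 (BAnd (FPair (3 + b) 0 (3 + x) (3 + y))
    (FPair (3 + b) 2 0 (3 + z))))).

(** The [sem_] lemmas compute the meaning of a formula by recursion on its syntax; [solve_sem]
    chains them. *)
Definition sem X (V : superstructure X) (e : nat -> V) p (P : Prop) :=
  holds e p <-> P.

Variables (X : Type) (V : superstructure X).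
Implicit Types (e : nat -> V) (p q : bformula).

Definition brel (r x y : V) := exists2 p, elem p r & is_pair p x y.

Definition bop (o x y z : V) :=
  exists2 t, elem t o & exists2 p, is_pair p x y & is_pair t p z.

Lemma sem_eq e i j : sem e (BEq i j) (e i = e j).
Proof. by []. Qed.

Lemma sem_mem e i j : sem e (BMem i j) (elem (e i) (e j)).
Proof. by []. Qed.

Lemma sem_not e p P : sem e p P -> sem e (BNot p) (~ P).
Proof. by rewrite /sem /= => ->. Qed.

Lemma sem_and e p q P Q : sem e p P -> sem e q Q -> sem e (BAnd p q) (P /\ Q).
Proof. by rewrite /sem /= => -> ->. Qed.

Lemma sem_or e p q P Q : sem e p P -> sem e q Q -> sem e (FOr p q) (P \/ Q).
Proof.
rewrite /sem /= => -> ->; split; last by move=> [h []|h []].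
by move=> h; apply: contrapT => /not_orP.
Qed.

Lemma sem_imp e p q P Q : sem e p P -> sem e q Q -> sem e (FImp p q) (P -> Q).
Proof.
rewrite /sem /= => -> ->; split=> [h hp|h [/h hq /(_ hq)//]].
by apply: contrapT => hq; apply: h.
Qed.

Lemma sem_iff e p q P Q : sem e p P -> sem e q Q -> sem e (FIff p q) (P <-> Q).
Proof. by move=> hp hq; apply: sem_and; apply: sem_imp. Qed.

Lemma sem_all e j p (P : V -> Prop) :
  (forall x, sem (scons x e) p (P x)) ->
  sem e (BAll j p) (forall x, elem x (e j) -> P x).
Proof. by move=> h; split=> /= H x /H /h. Qed.

Lemma sem_ex e j p (P : V -> Prop) :
  (forall x, sem (scons x e) p (P x)) ->
  sem e (FEx j p) (exists2 x, elem x (e j) & P x).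
Proof.
move=> h; split=> /= [H|[x xj Px] H]; last by apply: (H x xj); apply/h.
apply: contrapT => N; apply: H => x xj /h Px; apply: N; by exists x.
Qed.

Lemma sem_set e b x : e b = atoms V -> sem e (FSet b x) (is_set (e x)).
Proof. by rewrite /sem /= => ->; rewrite is_setE. Qed.

Lemma sem_upair e b c x y : e b = atoms V ->
  sem e (FUpair b c x y) (is_upair (e c) (e x) (e y)).
Proof.
move=> hb; rewrite /sem; split.
  move=> [/(sem_set _ hb) sc [xc [yc h]]]; split=> // z; split.
    by move=> /h h'; apply: contrapT => /not_orP.
  by case=> ->.
move=> [sc h]; split; first exact/sem_set.
split; first by apply/h; left.
split; first by apply/h; right.
by move=> z /h h' /= [? ?]; case: h'.
Qed.

Lemma sem_pair e b k x y : e b = atoms V ->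
  sem e (FPair b k x y) (is_pair (e k) (e x) (e y)).
Proof.
move=> hb.
have H : sem e (FPair b k x y) (exists2 u, elem u (e k) & exists2 v, elem v (e k)
   & is_upair u (e x) (e x) /\ is_upair v (e x) (e y) /\ is_upair (e k) u v).
  apply: sem_ex => u; apply: sem_ex => v.
  by apply: sem_and; [|apply: sem_and]; apply: sem_upair.
apply: (iff_trans H); split.
  by move=> [u up [v vp [h1 [h2 h3]]]]; exists u, v.
move=> [u [v [h1 h2 h3]]]; exists u; first by apply/(elem_upair _ h3); left.
by exists v => //; apply/(elem_upair _ h3); right.
Qed.

Lemma sem_rel e b r x y : e b = atoms V ->
  sem e (FRel b r x y) (brel (e r) (e x) (e y)).
Proof. by move=> hb; apply: sem_ex => p; apply: sem_pair. Qed.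

Lemma sem_op e b o x y z : e b = atoms V ->
  sem e (FOp b o x y z) (bop (e o) (e x) (e y) (e z)).
Proof.
move=> hb.
have H : sem e (FOp b o x y z) (exists2 t, elem t (e o) & exists2 w, elem w t
   & exists2 p, elem p w & is_pair p (e x) (e y) /\ is_pair t p (e z)).
  apply: sem_ex => t; apply: sem_ex => w; apply: sem_ex => p.
  by apply: sem_and; apply: sem_pair.
apply: (iff_trans H); split.
  by move=> [t to [w wt [p pw [h1 h2]]]]; exists t => //; exists p.
move=> [t to [p h1 h2]]; exists t => //; have [u [v [hu hv ht]]] := h2.
exists u; first by apply/(elem_upair _ ht); left.
by exists p => //; apply/(elem_upair _ hu); left.
Qed.

End Formulas.

(** * Free variables and renaming *)

Fixpoint bound p := match p with
  | BEq i j | BMem i j => maxn i.+1 j.+1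
  | BNot p => bound p
  | BAnd p q => maxn (bound p) (bound q)
  | BAll j p => maxn j.+1 (bound p).-1
  end.

Definition rup (r : nat -> nat) i := if i is j.+1 then (r j).+1 else 0.

Fixpoint rename (r : nat -> nat) p := match p with
  | BEq i j => BEq (r i) (r j)
  | BMem i j => BMem (r i) (r j)
  | BNot p => BNot (rename r p)
  | BAnd p q => BAnd (rename r p) (rename r q)
  | BAll j p => BAll (r j) (rename (rup r) p)
  end.

Lemma holds_bound X (V : superstructure X) p (e e' : nat -> V) :
  (forall i, i < bound p -> e i = e' i) -> holds e p <-> holds e' p.
Proof.
elim: p e e' => [i j|i j|p IH|p IHp q IHq|j p IH] e e' /= H.
- by rewrite !H // leq_max leqnn ?orbT.
- by rewrite !H // leq_max leqnn ?orbT.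
- by rewrite (IH e e').
- rewrite (IHp e e') ?(IHq e e') // => i h; apply: H; rewrite leq_max h ?orbT //.
- have h x : holds (scons x e) p <-> holds (scons x e') p.
    apply: IH => -[|i] //= hi; apply: H.
    by rewrite leq_max orbC -ltnS prednK ?hi // (leq_trans _ hi).
  by rewrite H ?leq_max ?leqnn //; split=> hh x /hh /h.
Qed.

Lemma holds_ext X (V : superstructure X) p (e e' : nat -> V) :
  (forall i, i < bound p -> e i = e' i) -> holds e p -> holds e' p.
Proof. by move=> /holds_bound ->. Qed.

Lemma holds_rename X (V : superstructure X) p r (e : nat -> V) :
  holds e (rename r p) <-> holds (e \o r) p.
Proof.
elim: p r e => [i j|i j|p IH|p IHp q IHq|j p IH] r e //=.
- by rewrite IH.
- by rewrite IHp IHq.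
- have h x : holds (scons x e) (rename (rup r) p) <-> holds (scons x (e \o r)) p.
    by rewrite IH; apply: holds_bound => -[].
  by split=> hh x /hh /h.
Qed.

(** * Transfer, internal separation and saturation *)

Ltac solve_sem := repeat first
  [ progress intros
  | lazymatch goal with |- sem _ ?p _ => lazymatch p with
    | FRel _ _ _ _ => apply: sem_rel
    | FOp _ _ _ _ _ => apply: sem_op
    | FPair _ _ _ _ => apply: sem_pair
    | FSet _ _ => apply: sem_set
    | FEx _ _ => apply: sem_ex
    | FOr _ _ => apply: sem_or
    | FImp _ _ => apply: sem_imp
    | FIff _ _ => apply: sem_iff
    | BAll _ _ => apply: sem_all
    | BAnd _ _ => apply: sem_and
    | BNot _ => apply: sem_not
    | BEq _ _ => apply: sem_eq
    | BMem _ _ => apply: sem_mem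
    end end
  | done ].

Section Transfer.
Variable W : nonstandard_universe.
Implicit Types (B v : nat -> std W) (e : nat -> ns W).

Lemma star_atoms : star (atoms (std W)) = atoms (ns W).
Proof. exact: star_base. Qed.

(** [P] is one reading of [phi] valid in all superstructures. Since [star] preserves the set of
    atoms, this reading applies on both sides of transfer. *)
Lemma transfer_sem phi
    (P : forall X (V : superstructure X), (nat -> V) -> Prop) v :
  (forall X (V : superstructure X) (e : nat -> V), e 0 = atoms V ->
    sem e phi (P X V e)) ->
  v 0 = atoms (std W) -> P _ _ v <-> P _ _ (star \o v).
Proof.
move=> h v0; have h1 := h _ _ v v0.
have h2 : sem (star \o v) phi (P _ _ (star \o v)).
  by apply: h; rewrite /= v0 star_atoms.
apply: iff_trans (iff_sym h1) _; apply: iff_trans _ h2; exact: transfer.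
Qed.

Lemma elem_star (a b : std W) : elem a b <-> elem (star a) (star b).
Proof. exact: (transfer (BMem 0 1) (scons a (fun=> b))). Qed.

Lemma star_inj (a b : std W) : star a = star b -> a = b.
Proof. by move/(transfer (BEq 0 1) (scons a (fun=> b))). Qed.

Lemma star_nonempty (b : std W) (x : ns W) : elem x (star b) ->
  exists y, elem y b.
Proof.
move=> xb; apply: contrapT => N.
have : holds (fun=> b) (BAll 0 (BNot (BEq 0 0))).
  by move=> y yb; case: N; exists y.
by move/transfer => /(_ x xb) [].
Qed.

(** Places 0 to M - j - 1 hold x_j, ..., x_(M-1), and the sets B_0, B_1, ... follow: the environment
    in which x_0, ..., x_(j-1) are still quantified. *)
Definition close_env (T : Type) M j (x B : nat -> T) i :=
  if i < M - j then x (i + j) else B (i + j - M).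

Lemma close_env_scons (T : Type) M j (x B : nat -> T) i : j < M ->
  scons (x j) (close_env M j.+1 x B) i = close_env M j x B i.
Proof.
move=> jM; case: i => [|i] /=; first by rewrite /close_env subn_gt0 jM.
by rewrite /close_env addSnnS -(subnSK jM) ltnS.
Qed.

(* The parameters are bound one at a time by quantifiers over the sets [B i],
   which sit in the environment after the [bound psi] free variables of
   [psi]: each quantifier then has the same index. *)
Lemma transfer_in B psi :
  (forall v, (forall i, elem (v i) (B i)) -> holds v psi) ->
  forall e, (forall i, elem (e i) (star (B i))) -> holds e psi.
Proof.
move=> H e eB; set M := bound psi.
pose cl j := iter j (BAll M.-1) psi.
have std_cl j : j <= M -> forall v, (forall i, elem (v i) (B i)) ->
    holds (close_env M j v B) (cl j).
  elim: j => [|j IH] jM v vB.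
    apply: holds_ext (H _ vB) => i iM.
    by rewrite /close_env subn0 addn0 iM.
  move=> y; have -> : close_env M j.+1 v B M.-1 = B j.
    rewrite /close_env ltnNge -subn1 leq_sub2l //=.
    by rewrite addnS -addSn subn1 prednK ?(leq_trans _ jM) // addKn.
  move=> yB; pose v' i := if i == j then y else v i.
  have v'B i : elem (v' i) (B i) by rewrite /v'; case: eqP => [->|].
  apply: holds_ext (IH (ltnW jM) _ v'B) => i _.
  rewrite -close_env_scons // /v' eqxx; case: i => [|i] //=.
  rewrite /close_env; case: ifP => // _; case: eqP => // ij.
  by move: (leq_addl i j.+1); rewrite ij ltnn.
(* Only the closed formula [cl M] is transferred. Its quantifiers are then instantiated with the
   e_j, outermost first, for j from M - 1 down to 0. *)
have ns_cl k : k <= M -> holds (close_env M (M - k) e (star \o B)) (cl (M - k)).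
  elim: k => [_|k IH kM].
    (* [std_cl] is relative to a choice of points in the sets B_i, which are nonempty because the
       e_i lie in their stars. *)
    have [v vB] := choice (fun i => star_nonempty (eB i)).
    rewrite subn0; apply: (@holds_ext _ _ _ (star \o B)).
      by move=> i _; rewrite /close_env subnn addnK.
    apply/transfer; apply: holds_ext (std_cl M (leqnn M) _ vB) => i _.
    by rewrite /close_env subnn addnK.
  set j := M - k.+1; have jM : j < M by rewrite ltn_subrL (leq_trans _ kM).
  have := IH (ltnW kM); rewrite -(subnSK kM) -/j => /(_ (e j)) h.
  apply: (@holds_ext _ _ _ (scons (e j) (close_env M j.+1 e (star \o B)))).
    by move=> i _; rewrite close_env_scons.
  apply: h; rewrite /close_env ltnNge -subn1 leq_sub2l //=.
  by rewrite addnS -addSn subn1 prednK ?(leq_trans _ jM) // addKn.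
have := ns_cl M (leqnn M); rewrite subnn; apply: holds_ext => i iM.
by rewrite /close_env subn0 addn0 iM.
Qed.

Lemma singleton_ex (a : std W) : exists b : std W, forall x, elem x b <-> x = a.
Proof.
have [n sa] := stage_ex a; exists (compr _ n [set a]) => x.
by rewrite elem_compr; split=> [[]//|->].
Qed.

Lemma star_singleton (a b : std W) : (forall x, elem x b <-> x = a) ->
  forall x, elem x (star b) <-> x = star a.
Proof.
move=> h x; split; last by move=> ->; apply/elem_star/h.
have : holds (scons a (fun=> b)) (BAll 1 (BEq 0 1)) by move=> y /h.
by move/transfer; exact.
Qed.

Lemma internal_star (a : std W) : internal (star a).
Proof. by have [b h] := singleton_ex a; exists b; apply/(star_singleton h). Qed.

Lemma internal_elem (a : std W) (x : ns W) : elem x (star a) -> internal x.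
Proof. by exists a. Qed.

(** Internal parameters are members of stars, so [transfer_in] applies to the standard statement
    that for all parameters from given sets the separated subset of [C] exists. [PC] is the power
    set of [C], one bound for all formulas. *)
Lemma internal_separation (C : std W) : exists PC : std W,
  forall phi e, (forall i, internal (e i)) ->
  exists s, [/\ elem s (star PC), is_set s
    & forall x, elem x s <-> elem x (star C) /\ holds (scons x e) phi].
Proof.
have [n sC] := stage_ex C.
exists (compr _ n.+1 [set s | is_set s /\ forall x, elem x s -> elem x C]).
set PC := compr _ _ _ => phi e ei.
(* Below the quantifiers the environment is x, s, atoms, [C], [PC], and then the parameters, which
   start at 5. *)
pose r i := if i is j.+1 then j + 5 else 0.
pose psi := FEx 2 (BAnd (FSet 1 0) (BAnd (BAll 0 (BMem 0 3))
  (BAll 2 (FIff (BMem 0 1) (rename r phi))))).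
have psiE X (V : superstructure X) (v : nat -> V) : v 0 = atoms V ->
    sem v psi (exists2 s, elem s (v 2) & is_set s
      /\ (forall x, elem x s -> elem x (v 1))
      /\ (forall x, elem x (v 1) -> elem x s <->
           holds (scons x (fun i => v (3 + i))) phi)).
  move=> v0; rewrite /psi; solve_sem; rewrite /sem; apply: (iff_trans (holds_rename _ _ _)).
  by apply: holds_bound => -[|i] //= _; rewrite addnC.
have [B eB] := choice ei.
(* Singleton domains pin the first three variables to fixed standard objects. *)
have [b0 h0] := singleton_ex (atoms (std W)).
have [b1 h1] := singleton_ex C.
have [b2 h2] := singleton_ex PC.
pose B' := scons b0 (scons b1 (scons b2 B)).
pose e' := scons (atoms (ns W)) (scons (star C) (scons (star PC) e)).
have : holds e' psi.
  apply: (@transfer_in B') => [v vB|].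
    apply/psiE; first by have /h0 := vB 0.
    have -> : v 1 = C by have /h1 := vB 1.
    have -> : v 2 = PC by have /h2 := vB 2.
    exists (compr _ n [set x | elem x C /\ holds (scons x (fun i => v (3 + i))) phi]).
      rewrite /PC; apply/elem_compr; split; last first.
        by split; [exact: compr_set|move=> x /elem_compr [_ []]].
      apply: stage_set; first exact: compr_set.
      by move=> x /elem_compr [].
    split; first exact: compr_set.
    split; first by move=> x /elem_compr [_ []].
    move=> x xC; split=> [/elem_compr [_ []]//|h].
    by apply/elem_compr; split; first exact: stage_elem xC.
  move=> [|[|[|i]]] /=.
  - by apply/(star_singleton h0); rewrite star_atoms.
  - exact/(star_singleton h1).
  - exact/(star_singleton h2).
  - exact: eB.
move/psiE => /(_ erefl) [s sPC [ss [sC' h]]]; exists s; split=> // x.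
by split=> [xs|[/h xC /xC]//]; split; [exact: sC'|apply/h => //; exact: sC'].
Qed.

Lemma saturation1 (C : std W) (phi : nat -> bformula) (e : nat -> nat -> ns W)
    (P : nat -> ns W -> Prop) :
  (forall n i, internal (e n i)) ->
  (forall n x, sem (scons x (e n)) (phi n) (P n x)) ->
  (forall n, exists2 x, elem x (star C) & forall k, k <= n -> P k x) ->
  exists2 x, elem x (star C) & forall n, P n x.
Proof.
move=> ei he H; have {}he n x : holds (scons x (e n)) (phi n) <-> P n x := he n x.
have [PC sep] := internal_separation C.
have [A hA] := choice (fun n => sep (phi n) (e n) (ei n)).
have [] := @saturation W A.
- by move=> n; have [h1 h2 _] := hA n; split=> //; exists PC.
- move=> n; have [x xC xP] := H n; exists x => k /xP {}xP.
  by have [_ _ hk] := hA k; apply/hk; split=> //; apply/he.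
move=> x h; exists x => [|n].
  by have [_ _ h0] := hA 0; have /h0 [] := h 0.
by have [_ _ hn] := hA n; have /hn [_ /he] := h n.
Qed.

(** The four points are chosen one after the other, each by saturating over the existence of the
    remaining ones; as the conditions decrease, finitely many of them amount to the last. *)
Lemma saturation4 (CX CY : std W) (phi : nat -> bformula)
    (e : nat -> nat -> ns W) (P : nat -> ns W -> ns W -> ns W -> ns W -> Prop) :
  (forall n i, internal (e n i)) ->
  (forall n, e n 1 = star CX) -> (forall n, e n 2 = star CY) ->
  (forall n x x' y y',
    sem (scons y' (scons y (scons x' (scons x (e n))))) (phi n) (P n x x' y y')) ->
  (forall n x x' y y', P n.+1 x x' y y' -> P n x x' y y') ->
  (forall n, exists2 x, elem x (star CX) & exists2 x', elem x' (star CX) &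
    exists2 y, elem y (star CY) & exists2 y', elem y' (star CY) & P n x x' y y') ->
  exists2 x, elem x (star CX) & exists2 x', elem x' (star CX) &
    exists2 y, elem y (star CY) & exists2 y', elem y' (star CY) &
    forall n, P n x x' y y'.
Proof.
move=> ei e1 e2 he dec H.
have decn m n x x' y y' : m <= n -> P n x x' y y' -> P m x x' y y'.
  by move=> /subnK <-; elim: (n - m) => // k IH; rewrite addSn => /dec /IH.
have [x xC Px] : exists2 x, elem x (star CX) & forall n,
    exists2 x', elem x' (star CX) & exists2 y, elem y (star CY) &
    exists2 y', elem y' (star CY) & P n x x' y y'.
  (* The bounds are entries 1, 2, 2 of [e n], shifted past the 1, 2, 3 variables bound before
     them. *)
  apply: (@saturation1 _ (fun n => FEx 2 (FEx 4 (FEx 5 (phi n)))) e) => //.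
    by move=> n x; rewrite -(e1 n) -(e2 n); solve_sem; exact: he.
  move=> n; have [x xC [x' x'C [y yC [y' y'C h]]]] := H n.
  exists x => // k kn; exists x' => //; exists y => //; exists y' => //.
  exact: decn h.
have [x' x'C Px'] : exists2 x', elem x' (star CX) & forall n,
    exists2 y, elem y (star CY) & exists2 y', elem y' (star CY) & P n x x' y y'.
  apply: (@saturation1 _ (fun n => FEx 4 (FEx 5 (phi n)))
    (fun n => scons x (e n))).
  - by move=> n [|i] //=; exact: internal_elem xC.
  - by move=> n x'; rewrite -(e2 n); solve_sem; exact: he.
  move=> n; have [x' x'C [y yC [y' y'C h]]] := Px n.
  exists x' => // k kn; exists y => //; exists y' => //; exact: decn h.
have [y yC Py] : exists2 y, elem y (star CY) & forall n,
    exists2 y', elem y' (star CY) & P n x x' y y'.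
  apply: (@saturation1 _ (fun n => FEx 5 (phi n))
    (fun n => scons x' (scons x (e n)))).
  - by move=> n [|[|i]] //=; [exact: internal_elem x'C|exact: internal_elem xC].
  - by move=> n y; rewrite -(e2 n); solve_sem; exact: he.
  move=> n; have [y yC [y' y'C h]] := Px' n.
  exists y => // k kn; exists y' => //; exact: decn h.
have [y' y'C Py'] : exists2 y', elem y' (star CY) & forall n, P n x x' y y'.
  apply: (@saturation1 _ phi (fun n => scons y (scons x' (scons x (e n))))).
  - move=> n [|[|[|i]]] //=; [exact: internal_elem yC|exact: internal_elem x'C|].
    exact: internal_elem xC.
  - by move=> n y'; exact: he.
  move=> n; have [y' y'C h] := Py n.
  exists y' => // k kn; exact: decn h.
by exists x => //; exists x' => //; exists y => //; exists y'.
Qed.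
End Transfer.

(** * Hypernatural arithmetic *)

Definition FClose b n o r x y a :=
  FEx n (BAnd (FOp b.+1 o.+1 x.+1 y.+1 0) (FRel b.+1 r.+1 0 a.+1)).

(** For [N], [o], [r] the naturals, the distance and an order, this reads |x - y| r a; [N] bounds
    the quantifier over the distance. *)
Definition close X (V : superstructure X) (N o r x y a : V) :=
  exists2 u, elem u N & bop o x y u /\ brel r u a.

Lemma sem_close X (V : superstructure X) (e : nat -> V) b n o r x y a :
  e b = atoms V ->
  sem e (FClose b n o r x y a) (close (e n) (e o) (e r) (e x) (e y) (e a)).
Proof. by move=> b0; rewrite /FClose /close; solve_sem. Qed.

Section Arithmetic.
Variable W : nonstandard_universe.

Lemma elem_natS (x : std W) : elem x (natS W) <-> exists n, x = nat_elt W n.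
Proof.
rewrite elem_compr; split=> [[_ [n _ <-]]|[n ->]]; first by exists n.
by split; [exists (nat_atom n)|exists n].
Qed.

Lemma nat_elt_inj m n : nat_elt W m = nat_elt W n -> m = n.
Proof. by move=> h; apply: nat_atom_inj; exact: atom_inj h. Qed.

Lemma stage_nat k n : stage (atom (std W)) (@elem _ (std W)) k (nat_elt W n).
Proof. by apply: (@stage_mono _ _ 0) => //; exists (nat_atom n). Qed.

Lemma stage_pair k (a b p : std W) : stage (atom _) (@elem _ _) k a ->
  stage (atom _) (@elem _ _) k b -> is_pair p a b ->
  stage (atom _) (@elem _ _) k.+2 p.
Proof.
by move=> ka kb hp; have [q hq sq] := pair_ex ka kb; rewrite (is_pair_uniq hp hq).
Qed.

Lemma rel_relS R m n :
  brel (relS W R) (nat_elt W m) (nat_elt W n) <-> R m n.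
Proof.
split=> [[p /elem_compr [_ [m' [n' [Rmn hp']]]] hp]|Rmn].
  by have [/nat_elt_inj -> /nat_elt_inj ->] := is_pair_inj hp hp'.
have [p hp] := is_pair_ex (nat_elt W m) (nat_elt W n); exists p => //.
apply/elem_compr; split; last by exists m, n.
by apply: stage_pair hp; exact: stage_nat.
Qed.

Lemma op_opS f m n (z : std W) :
  bop (opS W f) (nat_elt W m) (nat_elt W n) z <-> z = nat_elt W (f m n).
Proof.
split=> [[t /elem_compr [_ [m' [n' [q [hq ht']]]]] [p hp ht]]|->].
  have [? ->] := is_pair_inj ht ht'; subst q.
  by have [/nat_elt_inj -> /nat_elt_inj ->] := is_pair_inj hp hq.
have [p hp] := is_pair_ex (nat_elt W m) (nat_elt W n).
have [t ht] := is_pair_ex p (nat_elt W (f m n)).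
exists t; last by exists p.
apply/elem_compr; split; last by exists m, n, p.
apply: stage_pair ht; first by apply: stage_pair hp; exact: stage_nat.
exact: stage_nat.
Qed.

Lemma hrelE R (x y : ns W) : hrel R x y <-> brel (star (relS W R)) x y.
Proof. by split=> [[p [h1 h2]]|[p h1 h2]]; exists p. Qed.

Lemma hopE f (x y z : ns W) : hop f x y z <-> bop (star (opS W f)) x y z.
Proof.
by split=> [[p [t [h1 h2 h3]]]|[t h1 [p h2 h3]]]; [exists t => //; exists p|exists p, t].
Qed.

Definition dist m n := (m - n) + (n - m).

Definition arith_env (i : nat) : std W := nth (atoms _)
  [:: atoms _; natS W; relS W (fun m n => m <= n); relS W (fun m n => m < n);
      opS W dist; opS W addn] i.

Lemma hle_total (x y : ns W) : hypernat W x -> hypernat W y ->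
  hle x y \/ hle y x.
Proof.
have := @transfer_sem W (BAll 1 (BAll 2 (FOr (FRel 2 4 1 0) (FRel 2 4 0 1))))
  (fun X V e => forall x, elem x (e 1) -> forall y, elem y (e 1) ->
     brel (e 2) x y \/ brel (e 2) y x) arith_env.
case=> [X V e e0||H _ hx hy]; [by solve_sem|by []|].
move: H; rewrite /hle !hrelE; apply=> //.
move=> _ /elem_natS [m ->] _ /elem_natS [n ->].
by rewrite !rel_relS; apply/orP; exact: leq_total.
Qed.

Lemma hlt_trans (x y z : ns W) : hypernat W x -> hypernat W y -> hypernat W z ->
  hlt x y -> hlt y z -> hlt x z.
Proof.
have := @transfer_sem W (BAll 1 (BAll 2 (BAll 3 (FImp (FRel 3 6 2 1)
   (FImp (FRel 3 6 1 0) (FRel 3 6 2 0))))))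
  (fun X V e => forall x, elem x (e 1) -> forall y, elem y (e 1) ->
     forall z, elem z (e 1) -> brel (e 3) x y -> brel (e 3) y z -> brel (e 3) x z)
  arith_env.
case=> [X V e e0||H _ hx hy hz]; [by solve_sem|by []|].
move: H; rewrite /hlt !hrelE => H; apply: (H _ x hx y hy z hz).
move=> _ /elem_natS [m ->] _ /elem_natS [n ->] _ /elem_natS [k ->].
by rewrite !rel_relS; exact: ltn_trans.
Qed.

Lemma hadd_ex (x : ns W) : hypernat W x -> exists2 z, hypernat W z & hadd x x z.
Proof.
have := @transfer_sem W (BAll 1 (FEx 2 (FOp 2 7 1 1 0)))
  (fun X V e => forall x, elem x (e 1) -> exists2 z, elem z (e 1) &
     bop (e 5) x x z) arith_env.
case=> [X V e e0||H _ hx]; [by solve_sem|by []|].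
have [|z zN hz] := H _ x hx; last by exists z => //; apply/hopE.
move=> _ /elem_natS [m ->]; exists (nat_elt W (m + m)); last exact/op_opS.
by apply/elem_natS; exists (m + m).
Qed.

Lemma close_nat m n a :
  close (natS W) (opS W dist) (relS W (fun m n => m < n)) (nat_elt W m)
    (nat_elt W n) (nat_elt W a) <-> dist m n < a.
Proof.
split=> [[u _ [/op_opS -> /rel_relS]]//|h].
exists (nat_elt W (dist m n)); first by apply/elem_natS; exists (dist m n).
by split; [exact/op_opS|exact/rel_relS].
Qed.

Definition hclose_lt (x y a : ns W) :=
  close (star (natS W)) (star (opS W dist)) (star (relS W (fun m n => m < n))) x y a.
Definition hclose_le (x y a : ns W) :=
  close (star (natS W)) (star (opS W dist)) (star (relS W (fun m n => m <= n))) x y a.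

(* The step of the discrete intermediate value theorem for two paths [y], [z]
   that cross between times 1 and 2. *)
Lemma hclose_crossing (y1 y2 z1 z2 a s : ns W) :
  hypernat W y1 -> hypernat W y2 -> hypernat W z1 -> hypernat W z2 ->
  hypernat W a -> hypernat W s -> hle y1 z1 -> hle z2 y2 ->
  hclose_lt y1 y2 a -> hclose_lt z1 z2 a -> hadd a a s -> hclose_le y1 z1 s.
Proof.
have := @transfer_sem W (BAll 1 (BAll 2 (BAll 3 (BAll 4 (BAll 5 (BAll 6
  (FImp (FRel 6 8 5 3) (FImp (FRel 6 8 2 4) (FImp (FClose 6 7 10 9 5 4 1)
  (FImp (FClose 6 7 10 9 3 2 1) (FImp (FOp 6 11 1 1 0)
   (FClose 6 7 10 8 5 3 0))))))))))))
  (fun X V e => forall y1, elem y1 (e 1) -> forall y2, elem y2 (e 1) ->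
    forall z1, elem z1 (e 1) -> forall z2, elem z2 (e 1) ->
    forall a, elem a (e 1) -> forall s, elem s (e 1) ->
    brel (e 2) y1 z1 -> brel (e 2) z2 y2 -> close (e 1) (e 4) (e 3) y1 y2 a ->
    close (e 1) (e 4) (e 3) z1 z2 a -> bop (e 5) a a s ->
    close (e 1) (e 4) (e 2) y1 z1 s) arith_env.
case=> [X V e e0||H _ hy1 hy2 hz1 hz2 ha hs]; [by solve_sem; exact: sem_close|by []|].
rewrite /hle /hadd !hrelE hopE => l1 l2 c1 c2 haa.
apply: (H _ y1 hy1 y2 hy2 z1 hz1 z2 hz2 a ha s hs l1 l2 c1 c2 haa).
move=> {H}; rewrite /arith_env /=.
move=> _ /elem_natS [m1 ->] _ /elem_natS [m2 ->] _ /elem_natS [n1 ->].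
move=> _ /elem_natS [n2 ->] _ /elem_natS [k ->] _ /elem_natS [j ->].
rewrite !rel_relS !close_nat op_opS => l1' l2' c1' c2' /nat_elt_inj ->.
exists (nat_elt W (dist m1 n1)); first by apply/elem_natS; exists (dist m1 n1).
split; first exact/op_opS.
(* z1 - y1 is the sum of z1 - z2, z2 - y2 and y2 - y1, the middle one at most 0 and the others below
   a. *)
by apply/rel_relS; move: l1' l2' c1' c2'; rewrite /dist; lia.
Qed.

Lemma hclose_lt_trans (x y a b : ns W) : hypernat W a -> hypernat W b ->
  hlt a b -> hclose_lt x y a -> hclose_lt x y b.
Proof.
move=> ha hb ab [u uN [h1 h2]]; exists u => //; split=> //.
by apply/hrelE; apply: (hlt_trans uN ha hb) => //; apply/hrelE.
Qed.

Definition hzero : ns W := star (nat_elt W 0).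
Definition hone : ns W := star (nat_elt W 1).

Lemma hzero_neq_hone : hzero <> hone.
Proof. by move=> /star_inj /nat_elt_inj. Qed.

Lemma hypernat_star n : hypernat W (star (nat_elt W n)).
Proof. by rewrite /hypernat /elts /=; apply/elem_star/elem_natS; exists n. Qed.

(** The square of the naturals, whose star contains the graphs of maps from sets of hypernaturals to
    {0, 1}. *)
Definition nat_pairs := relS W (fun _ _ => True).

Lemma nat_pairs_ex (x y : ns W) : hypernat W x -> hypernat W y ->
  exists2 p, elem p (star nat_pairs) & is_pair p x y.
Proof.
have := @transfer_sem W (BAll 1 (BAll 2 (FRel 2 4 1 0)))
  (fun X V e => forall x, elem x (e 1) -> forall y, elem y (e 1) ->
     brel (e 2) x y)
  (fun i => nth (atoms _) [:: atoms _; natS W; nat_pairs] i).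
case=> [X V e e0||H _ hx hy]; [by solve_sem|by []|].
apply: (H _ x hx y hy).
by move=> _ /elem_natS [m ->] _ /elem_natS [n ->]; apply/rel_relS.
Qed.

End Arithmetic.

(** * Internal maps into {0, 1} *)

(** The clauses of [internal_maps] other than internality, in bounded form, with z and o for 0 and
    1: uniqueness of the value becomes the equivalence of having value z and not having value o. *)
Definition is_map X (V : superstructure X) (D z o xi : V) :=
  [/\ is_set xi,
      forall p, elem p xi ->
        exists2 d, elem d D & is_pair p d o \/ is_pair p d z
    & forall d, elem d D -> brel xi d z <-> ~ brel xi d o].

Definition FMap b D z o xi :=
  BAnd (FSet b xi) (BAnd
    (BAll xi (FEx D.+1 (FOr (FPair b.+2 1 0 o.+2) (FPair b.+2 1 0 z.+2))))
    (BAll D (FIff (FRel b.+1 xi.+1 0 z.+1) (BNot (FRel b.+1 xi.+1 0 o.+1))))).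

(** Finiteness of a difference is not an internal condition; this is one that implies it and holds
    for neighbours in a cube. *)
Definition two_points X (V : superstructure X) (D o x x' : V) :=
  exists2 d1, elem d1 D & exists2 d2, elem d2 D &
    forall d, elem d D -> d <> d1 -> d <> d2 -> brel x d o <-> brel x' d o.

Definition FTwo b D o x x' :=
  FEx D (FEx D.+1 (BAll D.+2 (FImp (BNot (BEq 0 2)) (FImp (BNot (BEq 0 1))
    (FIff (FRel b.+3 x.+3 0 o.+3) (FRel b.+3 x'.+3 0 o.+3)))))).

(** Taken for all n together, these conditions say that the difference is infinite; each single one
    is a bounded formula. *)
Definition not_covered X (V : superstructure X) (D o x x' : V) n :=
  forall g : nat -> V, (forall i, i < n -> elem (g i) D) ->
    exists2 d, elem d D &
      (forall i, i < n -> d <> g i) /\ ~ (brel x d o <-> brel x' d o).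

Fixpoint FNotIn k :=
  if k is j.+1 then BAnd (FNotIn j) (BNot (BEq 0 j.+1)) else BEq 0 0.

(* [k] is the number of points already bound. *)
Fixpoint FNotCovered n k b D o x x' :=
  if n is m.+1 then BAll D (FNotCovered m k.+1 b.+1 D.+1 o.+1 x.+1 x'.+1)
  else FEx D (BAnd (FNotIn k)
    (BNot (FIff (FRel b.+1 x.+1 0 o.+1) (FRel b.+1 x'.+1 0 o.+1)))).

Section MapFormulas.
Variables (X : Type) (V : superstructure X).
Implicit Types (e : nat -> V).

Lemma sem_map e b D z o xi : e b = atoms V ->
  sem e (FMap b D z o xi) (is_map (e D) (e z) (e o) (e xi)).
Proof.
move=> b0.
have H : sem e (FMap b D z o xi) (is_set (e xi) /\
    (forall p, elem p (e xi) ->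
      exists2 d, elem d (e D) & is_pair p d (e o) \/ is_pair p d (e z)) /\
    (forall d, elem d (e D) -> brel (e xi) d (e z) <-> ~ brel (e xi) d (e o))).
  by rewrite /FMap; solve_sem.
by apply: (iff_trans H); split=> [[? []]|[]].
Qed.

Lemma sem_two e b D o x x' : e b = atoms V ->
  sem e (FTwo b D o x x') (two_points (e D) (e o) (e x) (e x')).
Proof. by move=> b0; rewrite /FTwo /two_points; solve_sem. Qed.

Lemma sem_not_in e k : sem e (FNotIn k) (forall i, i < k -> e 0 <> e i.+1).
Proof.
elim: k => [|k IH]; first by split.
apply: (iff_trans (sem_and IH (sem_not (sem_eq _ _ _)))); split.
  by move=> [h hk] i; rewrite ltnS leq_eqVlt => /orP[/eqP ->|/h].
by move=> h; split=> [i ik|]; apply: h => //; exact: ltnW.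
Qed.

Lemma sem_not_covered_aux e n k b D o x x' : e b = atoms V ->
  sem e (FNotCovered n k b D o x x')
    (forall g : nat -> V, (forall i, i < n -> elem (g i) (e D)) ->
      exists2 d, elem d (e D) & (forall i, i < k -> d <> e i) /\
        (forall i, i < n -> d <> g i) /\
        ~ (brel (e x) d (e o) <-> brel (e x') d (e o))).
Proof.
elim: n e k b D o x x' => [|n IH] e k b D o x x' b0.
  have H : sem e (FNotCovered 0 k b D o x x') (exists2 d, elem d (e D) &
      (forall i, i < k -> d <> e i) /\
        ~ (brel (e x) d (e o) <-> brel (e x') d (e o))).
    apply: sem_ex => d; apply: sem_and; first exact: sem_not_in.
    by solve_sem.
  apply: (iff_trans H); split.
    by move=> [d dD [h1 h2]] g _; exists d.
  by move=> /(_ (fun=> e 0)) [] // d dD [h1 [_ h2]]; exists d.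
have H0 := sem_all (e := e) D
  (fun d0 => IH (scons d0 e) k.+1 b.+1 D.+1 o.+1 x.+1 x'.+1 b0).
apply: (iff_trans H0) => {H0 IH} /=.
split=> [H g gD|H d0 d0D g gD].
  have [//||d dD [h1 [h2 h3]]] := H (g n) _ g.
  - exact: gD.
  - by move=> i ni; apply: gD; exact: ltnW.
  exists d => //; split; first by move=> i ik; exact: (h1 i.+1).
  split=> // i; rewrite ltnS leq_eqVlt => /orP[/eqP ->|/h2//].
  exact: (h1 0).
have [|d dD [h1 [h2 h3]]] := H (fun i => if i == n then d0 else g i).
  move=> i; rewrite ltnS leq_eqVlt; case: eqP => //= _; exact: gD.
exists d => //; split; last first.
  split=> // i ni; have := h2 i (ltnW ni).
  by rewrite ltn_eqF.
move=> [_|i]; last exact: h1.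
by have := h2 n (ltnSn n); rewrite eqxx.
Qed.

Lemma sem_not_covered e n b D o x x' : e b = atoms V ->
  sem e (FNotCovered n 0 b D o x x') (not_covered (e D) (e o) (e x) (e x') n).
Proof.
move=> b0; apply: (iff_trans (sem_not_covered_aux _ _ _ _ _ _ b0)).
by split=> H g /H [d dD]; [move=> [_ h]|move=> h]; exists d.
Qed.

Lemma not_coveredW D o x x' n d0 : elem d0 D ->
  not_covered D o x x' n.+1 -> @not_covered X V D o x x' n.
Proof.
move=> d0D H g gD.
have [|d dD [h1 h2]] := H (fun i => if i < n then g i else d0).
  by move=> i _; case: ifP => // /gD.
exists d => //; split=> // i ni; have := h1 i (ltnW ni).
by rewrite ni.
Qed.

End MapFormulas.

Section Maps.
Variables (W : nonstandard_universe) (D : ns W).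
Implicit Types (x xi d : ns W).
Notation zero := (hzero W).
Notation one := (hone W).
Notation ismap := (is_map D zero one).

Lemma map_value xi d a : ismap xi -> elem d D -> value xi d a ->
  (a = one /\ brel xi d one) \/ (a = zero /\ ~ brel xi d one).
Proof.
move=> [_ h1 h2] dD [p pda pxi].
have [d' _ [hp|hp]] := h1 p pxi; have [? ?] := is_pair_inj pda hp; subst d' a.
  by left; split=> //; exists p.
by right; split=> //; apply/(h2 _ dD); exists p.
Qed.

Lemma value_map xi d : ismap xi -> elem d D ->
  (brel xi d one -> value xi d one) /\ (~ brel xi d one -> value xi d zero).
Proof.
move=> [_ _ h2] dD; split=> [[p h h']|]; first by exists p.
by move=> /(h2 _ dD) [p h h']; exists p.
Qed.

Lemma is_map_internal xi : internal xi -> ismap xi -> internal_maps D xi.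
Proof.
move=> ii hxi; have [h0 h1 h2] := hxi; split=> //.
  move=> p /h1 [d dD [hp|hp]].
    by exists d, one; split=> //; right.
  by exists d, zero; split=> //; left.
move=> d dD; have [v1 v0] := value_map hxi dD.
have [h|h] := pselect (brel xi d one).
  exists one; split; first exact: v1.
  by move=> b /(map_value hxi dD) [[]//|[_ /(_ h)]].
exists zero; split; first exact: v0.
by move=> b /(map_value hxi dD) [[_ /h]//|[]].
Qed.

Lemma map_diffE xi eta d : ismap xi -> ismap eta -> elem d D ->
  (exists a b, [/\ value xi d a, value eta d b & a <> b]) <->
  ~ (brel xi d one <-> brel eta d one).
Proof.
move=> mx me dD; have z1 := @hzero_neq_hone W; split.
  move=> [a [b [/(map_value mx dD) h1 /(map_value me dD) h2 ab]]] [i1 i2].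
  case: h1 => -[? h1]; case: h2 => -[? h2]; subst a b => //.
  - by apply: h2; exact: i1.
  - by apply: h1; exact: i2.
have [x1 x0] := value_map mx dD; have [e1 e0] := value_map me dD.
move=> N; have [h|h] := pselect (brel xi d one).
  exists one, zero; split; [exact: x1| |by move=> /esym].
  by apply: e0 => h'; apply: N.
exists zero, one; split; [exact: x0| |by []].
by apply: e1; apply: contrapT => h'; apply: N.
Qed.

Lemma F_fin_two xi eta : ismap xi -> ismap eta -> two_points D one xi eta ->
  F_fin D xi eta.
Proof.
move=> mx me [d1 _ [d2 _ h]].
apply: (@sub_finite_set _ _ [set d1; d2]); last by rewrite finite_setU; split.
move=> d [dD /(map_diffE mx me dD) N]; apply: contrapT => /not_orP [n1 n2].
by apply: N; exact: h.
Qed.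

(** A list enumerating a finite difference would cover it by as many points as its length. *)
Lemma not_F_fin xi eta : ismap xi -> ismap eta ->
  (forall n, not_covered D one xi eta n) -> ~ F_fin D xi eta.
Proof.
move=> mx me N.
move=> /(@finite_seqP {classic ns W}) [s hs].
have dS d : elem d D -> ~ (brel xi d one <-> brel eta d one) ->
    d \in (s : seq {classic ns W}).
  move=> dD /(map_diffE mx me dD) h.
  have : [set` s] d by rewrite -hs.
  by [].
have [|d dD [h1 h2]] := N (size s) (nth zero (s : seq (ns W))).
  move=> i si.
  have : [set` s] (nth zero (s : seq {classic ns W}) i) by exact: mem_nth.
  by rewrite -hs => -[].
have ds := dS d dD h2.
apply: (h1 (index (d : {classic ns W}) s)); first by rewrite index_mem.
exact: (esym (@nth_index {classic ns W} zero _ _ ds)).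
Qed.

(** The graph, made of the pairs (d, 1) where psi holds and (d, 0) where it fails, is separated from
    the star of [nat_pairs]; hence one [PN] serves for all formulas. *)
Lemma map_ex : elts D `<=` hypernat W -> internal D ->
  exists PN : std W, forall psi e, (forall i, internal (e i)) ->
  exists xi, [/\ elem xi (star PN), ismap xi &
    forall d, elem d D -> brel xi d one <-> holds (scons d e) psi].
Proof.
move=> DN Di; have [PN sep] := internal_separation (nat_pairs W).
exists PN => psi e ei.
pose r i := if i is j.+1 then j + 6 else 0.
pose phi := FEx 2 (FOr (BAnd (FPair 2 1 0 5) (rename r psi))
  (BAnd (FPair 2 1 0 4) (BNot (rename r psi)))).
pose e' := scons (atoms (ns W)) (scons D (scons zero (scons one e))).
have phiE p : sem (scons p e') phi (exists2 d, elem d D &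
   (is_pair p d one /\ holds (scons d e) psi) \/
   (is_pair p d zero /\ ~ holds (scons d e) psi)).
  rewrite /phi; solve_sem; rewrite /sem; apply: (iff_trans (holds_rename _ _ _));
    by apply: holds_bound => -[|i] //= _; rewrite addnC.
have [|s [sPN ss hs]] := sep phi e'.
  move=> [|[|[|[|i]]]] //=; try exact: internal_star.
  by rewrite -star_atoms; exact: internal_star.
have s1 d : elem d D -> brel s d one <-> holds (scons d e) psi.
  move=> dD; split=> [[p /hs [_ /phiE [d' _ h]] hp]|h].
    by case: h => -[hp' h]; have [e1 e2] := is_pair_inj hp hp';
      [rewrite e1|case: (@hzero_neq_hone W)].
  have [p pN hp] := nat_pairs_ex (DN _ dD) (hypernat_star W 1).
  by exists p => //; apply/hs; split=> //; apply/phiE; exists d => //; left.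
have s0 d : elem d D -> brel s d zero <-> ~ holds (scons d e) psi.
  move=> dD; split=> [[p /hs [_ /phiE [d' _ h]] hp]|h].
    by case: h => -[hp' h]; have [e1 e2] := is_pair_inj hp hp';
      [case: (@hzero_neq_hone W)|rewrite e1].
  have [p pN hp] := nat_pairs_ex (DN _ dD) (hypernat_star W 0).
  by exists p => //; apply/hs; split=> //; apply/phiE; exists d => //; right.
exists s; split=> //; split=> //.
  move=> p /hs [_ /phiE [d dD h]]; exists d => //.
  by case: h => -[]; [left|right].
by move=> d dD; rewrite s1 // s0.
Qed.

(** Through [map_ex] this makes the characteristic function of {e_i : i in c} an internal map. *)
Fixpoint FMemSeq (c : seq nat) :=
  if c is i :: c' then FOr (BEq 0 i.+1) (FMemSeq c') else BNot (BEq 0 0).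

Lemma holds_FMemSeq (e : nat -> ns W) c x :
  holds (scons x e) (FMemSeq c) <-> exists2 i, i \in c & x = e i.
Proof.
elim: c => [|i c IH]; first by split=> [[]//|[]].
apply: (iff_trans (sem_or (sem_eq _ _ _) IH)); split.
  by move=> [/= ->|[j jc ->]]; [exists i; rewrite ?mem_head|exists j => //; rewrite inE jc orbT].
move=> [j]; rewrite inE => /orP[/eqP -> ->|jc ->]; [by left|right; by exists j].
Qed.
End Maps.

(** * Cubes of maps *)

Lemma nat_ultrafilter : exists G : set_system nat,
  UltraFilter G /\ forall n, G [set m | n <= m].
Proof.
have [G [GU sG]] := ultraFilterLemma eventually_filter.
by exists G; split=> // n; apply: sG; exists n.
Qed.

Section UltraQuantifier.
Variables (G : set_system nat) (GU : UltraFilter G).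
Hypothesis G_ge : forall n, G [set m | n <= m].

(* The [n]-fold product of the ultrafilter [G]. *)
Fixpoint upower n (P : set (seq nat)) : Prop :=
  if n is m.+1 then G [set i | upower m (fun c => P (i :: c))] else P [::].

Lemma upowerS n P Q : P `<=` Q -> upower n P -> upower n Q.
Proof.
elim: n P Q => [|n IH] P Q PQ /=; first exact: PQ.
apply: filterS => i; apply: IH => c; exact: PQ.
Qed.

Lemma upowerI n P Q : upower n P -> upower n Q -> upower n (P `&` Q).
Proof.
elim: n P Q => [|n IH] P Q //= hP hQ.
by apply: filterS (filterI hP hQ) => i [h1 h2]; exact: IH.
Qed.

Lemma upowerC n P : ~ upower n P -> upower n (~` P).
Proof.
elim: n P => [|n IH] P //= hP.
have [//|] := in_ultra_setVsetC [set i | upower n (fun c => P (i :: c))] GU.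
by apply: filterS => i; exact: IH.
Qed.

Lemma ultra_ex (A : set nat) : G A -> exists i, A i.
Proof. exact: filter_ex. Qed.

Lemma upower_ex n P : upower n P -> exists c, P c.
Proof.
elim: n P => [|n IH] P /=; first by exists [::].
by move=> /ultra_ex [i /IH [c Pc]]; exists (i :: c).
Qed.

Lemma ultra_notin (A : set nat) (s : seq nat) : G A ->
  exists2 i, A i & i \notin s.
Proof.
move=> GA; have [i [Ai /= si]] := ultra_ex (filterI GA (G_ge (sumn s).+1)).
exists i => //; apply/negP => is_; move: si; rewrite ltnNge => /negP; apply.
by elim: s is_ => //= x s IH; rewrite inE => /orP[/eqP ->|/IH]; lia.
Qed.

(** The section of P is large for G-most first coordinates, so two distinct fresh ones x and y can
    be taken; the intersection of their sections is large again, and the induction continues in it.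
    Only the vertices on two antipodal paths are recorded. *)
Lemma upower_cube n P (s : seq nat) : upower n P -> exists a b : seq nat,
  [/\ size a = n, size b = n, uniq (a ++ b), (forall i, i \in a ++ b -> i \notin s)
    & forall i, i <= n -> P (take i b ++ drop i a) /\ P (take i a ++ drop i b)].
Proof.
elim: n P s => [|n IH] P s /= hP.
  by exists [::], [::]; split=> // -[].
have [x hx xs] := ultra_notin s hP.
have [y hy] := ultra_notin (x :: s) hP; rewrite inE => /norP[yx ys].
have [a [b [sa sb uab abs h]]] := IH _ (x :: y :: s) (upowerI hx hy).
have xab : x \notin a ++ b by apply/negP => /abs; rewrite mem_head.
have yab : y \notin a ++ b by apply/negP => /abs; rewrite !inE eqxx orbT.
have uxy : uniq (x :: (a ++ y :: b)).
  have /perm_uniq <- : perm_eq (y :: x :: (a ++ b)) (x :: (a ++ y :: b)).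
    by apply/permP => Q; rewrite /= !count_cat /=; lia.
  by rewrite /= inE negb_or yx yab xab.
exists (x :: a), (y :: b); split=> /=; rewrite ?sa ?sb //.
- move=> i; rewrite inE mem_cat inE => /or3P[/eqP ->//| |/orP[/eqP ->//|]] ih.
    by have := abs i; rewrite mem_cat ih !inE => /(_ isT) /norP[_ /norP[]].
  by have := abs i; rewrite mem_cat ih orbT !inE => /(_ isT) /norP[_ /norP[]].
(* Once the first coordinate is switched, the tails are those at i - 1; at i = 0 they are [a] and
   [b], unswitched. *)
- move=> [_|i /= ni]; last by have [[_ ?] [? _]] := h i ni.
  by have := h 0 (leq0n _); rewrite !take0 !drop0 => -[[? _] [_ ?]].
Qed.

End UltraQuantifier.

(** Going down from n, the first i with p i below q i is a crossing. *)
Lemma crossing (T : Type) (le : T -> T -> Prop) (p q : nat -> T) n :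
  (forall i, le (p i) (q i) \/ le (q i) (p i)) ->
  0 < n -> le (p 0) (q 0) -> le (q n) (p n) ->
  exists2 i, i < n & le (p i) (q i) /\ le (q i.+1) (p i.+1).
Proof.
move=> tot; elim: n => // n IH _ l0 ln.
have [h|h] := tot n; first by exists n.
have [n0|n0] := posnP n; first by subst n; exists 0.
by have [i ni hi] := IH n0 l0 h; exists i => //; exact: ltnW.
Qed.

(** Antipodal vertices share out the points of the cube, so they are disjoint when [a ++ b] has no
    repetition. *)
Lemma perm_exchange (T : eqType) (a b : seq T) i :
  perm_eq ((take i b ++ drop i a) ++ (take i a ++ drop i b)) (a ++ b).
Proof.
apply/permP => P; rewrite -{3}(cat_take_drop i a) -{3}(cat_take_drop i b).
by rewrite !count_cat; lia.
Qed.

(** * Antipodal vertices with close values *)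

Section Main.
Variables (W : nonstandard_universe) (D : ns W).
Hypothesis D_internal : internal D.
Variable PN : std W.
Implicit Types (x y : ns W).
Notation zero := (hzero W).
Notation one := (hone W).
Notation ismap := (is_map D zero one).
Notation N := (hypernat W).

Definition linked (B x x' y y' : ns W) :=
  [/\ ismap x, ismap x', brel B x y & brel B x' y'].

(* Variables 0 to 3 stand for y', y, x', x, and variable 4 + i for entry i of
   [main_env] below. *)
Definition FLinked := BAnd (FMap 4 7 8 9 3) (BAnd (FMap 4 7 8 9 2)
  (BAnd (FRel 4 10 3 1) (FRel 4 10 2 0))).

Definition main_env (R : nat -> nat -> Prop) (B a : ns W) i := nth (atoms _)
  [:: atoms _; star PN; star (natS W); D; zero; one; B; a; star (relS W R);
      star (opS W dist)] i.

Lemma main_env_internal R B a i : internal B -> N a ->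
  internal (main_env R B a i).
Proof.
move=> iB Na; have i0 : internal (atoms (ns W)).
  by rewrite -star_atoms; exact: internal_star.
do 10 (case: i => [|i]; first by [|exact: internal_star|exact: internal_elem Na]).
by rewrite /main_env nth_default.
Qed.

Lemma sem_linked R B a x x' y y' :
  sem (scons y' (scons y (scons x' (scons x (main_env R B a))))) FLinked
    (linked B x x' y y').
Proof.
have H : sem (scons y' (scons y (scons x' (scons x (main_env R B a))))) FLinked
    (ismap x /\ ismap x' /\ brel B x y /\ brel B x' y').
  apply: sem_and; first exact: sem_map.
  apply: sem_and; first exact: sem_map.
  by solve_sem.
by apply: (iff_trans H); split=> [[? [? []]]|[]].
Qed.

Lemma linkedS B B' x x' y y' : elts B `<=` elts B' ->
  linked B x x' y y' -> linked B' x x' y y'.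
Proof.
move=> BB [mx mx' [p pB hp] [q qB hq]].
by split=> //; [exists p => //; exact: BB|exists q => //; exact: BB].
Qed.

Variable B : nat -> ns W.
Hypothesis B_internal : forall n, internal (B n).
Hypothesis B_dec : forall n, elts (B n.+1) `<=` elts (B n).

Lemma B_decn m n : m <= n -> elts (B n) `<=` elts (B m).
Proof.
move=> /subnK <-; elim: (n - m) => [|k IH] x //.
by rewrite addSn => /B_dec /IH.
Qed.

(** Counterexamples for all k would satisfy conditions that decrease with k, since B_k shrinks and
    a_k grows; saturation would yield one counterexample for all k, against the hypothesis. *)
Lemma uniform_step (a : nat -> ns W) :
  (forall n, N (a n)) -> (forall n, hlt (a n) (a n.+1)) ->
  (forall x x' y y', elem x (star PN) -> elem x' (star PN) -> N y -> N y' ->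
    (forall n, linked (B n) x x' y y') -> two_points D one x x' ->
    exists n, hclose_lt y y' (a n)) ->
  exists k, forall x x' y y', elem x (star PN) -> elem x' (star PN) ->
    N y -> N y' -> linked (B k) x x' y y' -> two_points D one x x' ->
    hclose_lt y y' (a k).
Proof.
move=> aN a_inc H; apply: contrapT => /forallNP NH.
pose P n x x' y y' :=
  linked (B n) x x' y y' /\ two_points D one x x' /\ ~ hclose_lt y y' (a n).
have [|||||n|x xP [x' x'P [y yN [y' y'N h]]]] :=
  @saturation4 W PN (natS W)
    (fun=> BAnd FLinked (BAnd (FTwo 4 7 9 3 2) (BNot (FClose 4 6 13 12 1 0 11))))
    (fun n => main_env (fun m n => m < n) (B n) (a n)) P.
- by move=> n i; exact: main_env_internal.
- by [].
- by [].
- move=> n x x' y y'; apply: sem_and; first exact: sem_linked.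
  apply: sem_and; first exact: sem_two.
  by apply: sem_not; exact: sem_close.
- move=> n x x' y y' [h1 [h2 h3]]; split; first exact: linkedS h1.
  split=> // h4; apply: h3; exact: hclose_lt_trans h4.
- apply: contrapT => C; apply: (NH n) => x x' y y' xP x'P yN y'N h1 h2.
  apply: contrapT => h3; apply: C; exists x => //; exists x' => //.
  by exists y => //; exists y'.
have [n] := H x x' y y' xP x'P yN y'N (fun n => proj1 (h n)) (proj1 (proj2 (h 0))).
by have [_ []] := h n.
Qed.

(** The bound s is the same for all n, so the conditions decrease and can be saturated; [d0] pads
    lists of points when [not_covered] is weakened from n + 1 to n. *)
Lemma far_pair_limit (s d0 : ns W) : elem d0 D -> N s ->
  (forall n, exists x x' y y', [/\ [/\ elem x (star PN), elem x' (star PN), N y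
    & N y'], linked (B n) x x' y y', not_covered D one x x' n
    & hclose_le y y' s]) ->
  exists x x' y y', [/\ [/\ elem x (star PN), elem x' (star PN), N y & N y'],
    forall n, linked (B n) x x' y y', forall n, not_covered D one x x' n
    & hclose_le y y' s].
Proof.
move=> d0D sN H.
pose P n x x' y y' :=
  linked (B n) x x' y y' /\ not_covered D one x x' n /\ hclose_le y y' s.
have [|||||n|x xP [x' x'P [y yN [y' y'N h]]]] :=
  @saturation4 W PN (natS W)
    (fun n => BAnd FLinked (BAnd (FNotCovered n 0 4 7 9 3 2)
       (FClose 4 6 13 12 1 0 11)))
    (fun n => main_env (fun m n => m <= n) (B n) s) P.
- by move=> n i; exact: main_env_internal.
- by [].
- by [].
- move=> n x x' y y'; apply: sem_and; first exact: sem_linked.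
  apply: sem_and; first exact: sem_not_covered.
  exact: sem_close.
- move=> n x x' y y' [h1 [h2 h3]]; split; first exact: linkedS h1.
  by split=> //; exact: not_coveredW d0D h2.
- have [x [x' [y [y' [[xP x'P yN y'N] h1 h2 h3]]]]] := H n.
  by exists x => //; exists x' => //; exists y => //; exists y'.
exists x, x', y, y'; split=> [//|n|n|]; [exact: (h n).1|exact: (h n).2.1|].
exact: (h 0).2.2.
Qed.

Variables (ds : nat -> ns W) (chi : seq nat -> ns W).
Hypothesis ds_inj : injective ds.
Hypothesis ds_D : forall i, elem (ds i) D.
Hypothesis chi_map : forall c, ismap (chi c).
Hypothesis chi_PN : forall c, elem (chi c) (star PN).
Hypothesis chiE : forall c d, elem d D ->
  brel (chi c) d one <-> exists2 i, i \in c & d = ds i.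

(** Step i of the path only exchanges the i-th point of [a] for the i-th point of [b]. *)
Lemma chi_two_points a b i : size a = size b -> i < size a ->
  two_points D one (chi (take i b ++ drop i a))
    (chi (take i.+1 b ++ drop i.+1 a)).
Proof.
move=> sab ia; exists (ds (nth 0 a i)) => //; exists (ds (nth 0 b i)) => //.
move=> d dD da db; rewrite !chiE //.
rewrite (take_nth 0) -?sab // (drop_nth 0 ia) cat_rcons.
split=> -[j]; rewrite mem_cat inE => /or3P[jb|/eqP ->|ja] dj; subst d => //.
- by exists j => //; rewrite mem_cat jb.
- by exists j => //; rewrite mem_cat inE ja !orbT.
- by exists j => //; rewrite mem_cat jb.
- by exists j => //; rewrite mem_cat inE ja !orbT.
Qed.

(** Pigeonhole: the maps differ at every ds_j with j in [c], so a cover by n points would inject [c]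
    into n indices. *)
Lemma chi_not_covered c c' n : uniq c -> n < size c ->
  (forall i, i \in c -> i \notin c') -> not_covered D one (chi c) (chi c') n.
Proof.
move=> uc nc cc' g gD; apply: contrapT => C.
have cov j : exists k, j \in c -> k < n /\ ds j = g k.
  have [jc|jc] := boolP (j \in c); last by exists 0.
  apply: contrapT => /forallNP Nk; apply: C; exists (ds j) => //; split.
    by move=> k kn e; apply: (Nk k).
  rewrite !chiE // => -[/(_ (ex_intro2 _ _ j jc erefl)) [k kc' /ds_inj jk]] _.
  by have := cc' j jc; rewrite jk kc'.
have [f fP] := choice cov.
have : size (map f c) <= size (iota 0 n).
  apply: uniq_leq_size.
    rewrite map_inj_in_uniq // => j k jc kc fjk.
    apply: ds_inj; have [_ ->] := fP _ jc; have [_ ->] := fP _ kc.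
    by rewrite fjk.
  by move=> _ /mapP[j jc ->]; have [fn _] := fP _ jc; rewrite mem_iota add0n.
by rewrite size_map size_iota leqNgt nc.
Qed.

Definition has_value x Bn := exists2 y, N y & brel Bn x y.

(* [take i b ++ drop i a], for [i] from 0 to [size a], is a path from [a] to
   [b] in the cube, and [take i a ++ drop i b] is the antipodal path; their
   images cross. *)
Lemma far_pair_of_cube a0 s n k (a b : seq nat) : N a0 -> N s -> hadd a0 a0 s ->
  (forall x x' y y', elem x (star PN) -> elem x' (star PN) ->
    N y -> N y' -> linked (B k) x x' y y' -> two_points D one x x' ->
    hclose_lt y y' a0) ->
  size a = size b -> n < size a -> uniq (a ++ b) ->
  (forall i, i <= size a ->
    has_value (chi (take i b ++ drop i a)) (B (maxn n k)) /\
    has_value (chi (take i a ++ drop i b)) (B (maxn n k))) ->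
  exists x x' y y', [/\ [/\ elem x (star PN), elem x' (star PN), N y
    & N y'], linked (B n) x x' y y', not_covered D one x x' n
    & hclose_le y y' s].
Proof.
(* Level max(n, k) serves both the step bound at k and the conclusion at n. *)
move=> a0N sN a0s step; set m := maxn n k.
(* One value is fixed for each vertex, so each path ends at the value where the other starts; where
   there is none, x is a dummy. *)
have value_ex x : exists y, has_value x (B m) -> N y /\ brel (B m) x y.
  have [[y yN xy]|h] := pselect (has_value x (B m)); first by exists y.
  by exists x.
have [Y hY] := choice value_ex.
have le_k : elts (B m) `<=` elts (B k) by apply: B_decn; rewrite leq_maxr.
have le_n : elts (B m) `<=` elts (B n) by apply: B_decn; rewrite leq_maxl.
have linkedY c c' : has_value (chi c) (B m) -> has_value (chi c') (B m) ->
    linked (B m) (chi c) (chi c') (Y (chi c)) (Y (chi c')).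
  by move=> /hY [_ h] /hY [_ h'].
have stepY c d i : size c = size d -> i < size c ->
    (forall j, j <= size c -> has_value (chi (take j d ++ drop j c)) (B m)) ->
    hclose_lt (Y (chi (take i d ++ drop i c)))
      (Y (chi (take i.+1 d ++ drop i.+1 c))) a0.
  move=> scd ic hv; have h1 := hv i (ltnW ic); have h2 := hv _ ic.
  apply: (step (chi (take i d ++ drop i c)) (chi (take i.+1 d ++ drop i.+1 c))) => //.
  - exact: (hY _ h1).1.
  - exact: (hY _ h2).1.
  - exact: linkedS le_k (linkedY _ _ h1 h2).
  - exact: chi_two_points.
pose y0 (c : seq nat) := Y (chi c).
wlog l0 : a b / hle (y0 a) (y0 b).
  move=> wl sab na uab hv.
  have hN c : has_value (chi c) (B m) -> N (y0 c) by move=> /hY [].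
  have [ha hb] : N (y0 a) /\ N (y0 b).
    have := hv 0 (leq0n _); rewrite !take0 !drop0 => -[h1 h2].
    by split; exact: hN.
  have [l|l] := hle_total ha hb; first exact: (wl a b).
  apply: (wl b a) => //; first by rewrite -sab.
    by rewrite uniq_catC.
  by move=> i; rewrite -sab => /hv [].
move=> sab na uab hv.
pose p i := take i b ++ drop i a; pose q i := take i a ++ drop i b.
have hp i : i <= size a -> has_value (chi (p i)) (B m) by move=> /hv [].
have hq i : i <= size a -> has_value (chi (q i)) (B m) by move=> /hv [].
have [i ia [l1 l2]] : exists2 i, i < size a &
    hle (y0 (p i)) (y0 (q i)) /\ hle (y0 (q i.+1)) (y0 (p i.+1)).
  (* Indices are cut off at [size a], because [crossing] asks for comparability at every index. *)
  pose p' i := y0 (p (minn i (size a))); pose q' i := y0 (q (minn i (size a))).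
  have [||||i ia] := @crossing _ (@hle W) p' q' (size a).
  - move=> i; apply: hle_total; apply: (hY _ _).1; [apply: hp|apply: hq]; exact: geq_minr.
  - exact: leq_trans na.
  - by rewrite /p' /q' /p /q min0n !take0 !drop0.
  - rewrite /p' /q' /p /q minnn drop_size take_size cats0.
    by rewrite [size a]sab drop_size take_size cats0.
  by rewrite /p' /q' (minn_idPl (ltnW ia)) (minn_idPl ia); exists i.
have ia' := ltnW ia.
have pq := perm_exchange a b i; rewrite -(perm_uniq pq) in uab.
move: uab; rewrite cat_uniq => /and3P[up /hasPn dis _].
exists (chi (p i)), (chi (q i)), (y0 (p i)), (y0 (q i)); split.
- split=> //; [exact: (hY _ (hp _ ia')).1|exact: (hY _ (hq _ ia')).1].
- by apply: linkedS le_n _; apply: linkedY; [exact: hp|exact: hq].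
- apply: chi_not_covered up _ _.
    by rewrite size_cat size_drop size_takel -?sab ?subnKC.
  by move=> j jp; apply/negP => jq; have := dis j jq; rewrite /= jp.
- have bnd c d j : size c = size d -> N (y0 c) -> True by [].
  apply: (hclose_crossing (y2 := y0 (p i.+1)) (z2 := y0 (q i.+1)) (a := a0)) => //.
  + exact: (hY _ (hp _ ia')).1.
  + exact: (hY _ (hp _ ia)).1.
  + exact: (hY _ (hq _ ia')).1.
  + exact: (hY _ (hq _ ia)).1.
  + exact: stepY.
  + by apply: stepY => //; rewrite -?sab.
Qed.
End Main.

(** * The limit type and the contradiction *)

Lemma infinite_injection (T : Type) (A : set T) : infinite_set A ->
  exists2 f : nat -> T, injective f & forall i, A (f i).
Proof.
move=> /infiniteP /card_leP [f].
exists (fun i => val (f (SigSub (mem_setT i)))).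
  by move=> i j /val_inj /(inj (mem_setT _) (mem_setT _)) [].
by move=> i; exact: set_mem (valP (f _)).
Qed.

Lemma upower_forall (G : set_system nat) (GU : UltraFilter G)
    (P : nat -> set (seq nat)) :
  (forall k, G [set m | upower G m (P k)]) ->
  forall n, G [set m | upower G m [set c | forall k, k <= n -> P k c]].
Proof.
move=> H; elim=> [|n IH].
  apply: filterS (H 0) => m; apply: upowerS => c Pc k.
  by rewrite leqn0 => /eqP ->.
apply: filterS (filterI IH (H n.+1)) => m [h1 h2].
apply: upowerS (upowerI GU h1 h2) => c [c1 c2] k.
by rewrite leq_eqVlt => /orP[/eqP ->//|]; exact: c1.
Qed.

(** A property of vertices or its negation is large, so any finitely many clauses of the limit type
    hold at some [chi c]; as there are countably many s, saturation realizes the whole type. *)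
Lemma generic_map (W : nonstandard_universe) (D : ns W) (PN : std W)
    (A : seq bool -> ns W) (chi : seq nat -> ns W)
    (G : set_system nat) (GU : UltraFilter G) :
  internal D -> (forall s, internal (A s)) ->
  (forall c, elem (chi c) (star PN)) ->
  (forall c, is_map D (hzero W) (hone W) (chi c)) ->
  exists x, [/\ elem x (star PN), is_map D (hzero W) (hone W) x &
    forall s, has_value x (A s) <->
      G [set n | upower G n [set c | has_value (chi c) (A s)]]].
Proof.
move=> Di Ai chi_PN chi_map.
pose tau s := G [set n | upower G n [set c | has_value (chi c) (A s)]].
pose sq n : seq bool := odflt [::] (unpickle n).
pose P n x := is_map D (hzero W) (hone W) x /\
  (has_value x (A (sq n)) <-> tau (sq n)).
(* The truth of [tau] is decided outside the formula, which then asserts or denies a value in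
   A_s. *)
pose phi n := BAnd (FMap 1 4 5 6 0) (if `[< tau (sq n) >] then
  FEx 3 (FRel 2 8 1 0) else BNot (FEx 3 (FRel 2 8 1 0))).
have hv n x : sem (scons x (main_env D PN (fun _ _ => True) (A (sq n)) (hzero W)))
    (FEx 3 (FRel 2 8 1 0)) (has_value x (A (sq n))).
  by apply: (@sem_ex _ _ _ _ _ (fun y => brel (A (sq n)) x y)) => y; exact: sem_rel.
have [||n|x xP hx] := @saturation1 W PN phi
  (fun n => main_env D PN (fun _ _ => True) (A (sq n)) (hzero W)) P.
- by move=> n i; apply: main_env_internal => //; exact: (hypernat_star W 0).
- move=> n x; apply: sem_and; first exact: sem_map.
  have {}hv := hv n x; case: asboolP => t; rewrite /sem.
    by apply: (iff_trans hv); split=> [h|[_ /(_ t)]//]; split.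
  by apply: (iff_trans (sem_not hv)); split=> [h|[h _ /h]//]; split.
- have : forall k, G [set m | upower G m
      [set c | has_value (chi c) (A (sq k)) <-> tau (sq k)]].
    move=> k; have [t|t] := pselect (tau (sq k)).
      by apply: filterS (t) => m; apply: upowerS.
    have [//|] := in_ultra_setVsetC
      [set n | upower G n [set c | has_value (chi c) (A (sq k))]] GU.
    by apply: filterS => m /(upowerC GU); apply: upowerS => c; split.
  move=> /(upower_forall GU)/(_ n)/(ultra_ex GU) [m /(upower_ex GU) [c hc]].
  by exists (chi c) => // k kn; split=> //; exact: hc.
exists x; split=> //; first exact: (hx 0).1.
by move=> s; have := (hx (pickle s)).2; rewrite /sq pickleK.
Qed.

Theorem theorem13p3 (W : nonstandard_universe) (D : ns W) (U : set (ns W))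
    (D_sub : elts D `<=` hypernat W) (D_hyperfinite : hyperfinite D)
    (D_infinite : infinite_set (elts D))
    (U_cut : cut U) (U_additive : additive U)
    (U_cofinal : countably_cofinal U) :
  ~ CD_reducible (internal_maps D) (F_fin D) (hypernat W) (E_cut U).
Proof.
move=> [theta [thN [F [A [Ais Adec Agr]]] red]].
have Ai s := (Ais s).2.
have Di : internal D := internal_elem D_hyperfinite.
have [ds ds_inj ds_D] := infinite_injection D_infinite.
have dsi i : internal (ds i) := internal_elem (D_sub _ (ds_D i)).
have [PN mapP] := map_ex D_sub Di.
have [chi chiP] := choice (fun c => mapP (FMemSeq c) ds dsi).
have chi_PN c : elem (chi c) (star PN) by have [] := chiP c.
have chi_map c : is_map D (hzero W) (hone W) (chi c) by have [] := chiP c.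
have chiE c d : elem d D ->
    brel (chi c) d (hone W) <-> exists2 i, i \in c & d = ds i.
  move=> dD; have [_ _ h] := chiP c.
  exact: (iff_trans (h d dD) (holds_FMemSeq _ _ _)).
have [G [GU G_ge]] := nat_ultrafilter.
have [x0 [x0P x0map x0tau]] := generic_map GU Di Ai chi_PN chi_map.
have mapS x : elem x (star PN) -> is_map D (hzero W) (hone W) x ->
    internal_maps D x.
  by move=> /internal_elem; exact: is_map_internal.
have x0S := mapS _ x0P x0map.
have [p0 hp0] := is_pair_ex x0 (theta x0).
(* The point of the graph above x0 selects the branch f. It lies in every B_m, so by genericity B_m
   has points above most vertices. *)
have : graph (internal_maps D) theta p0 by exists x0.
rewrite Agr => -[f Ff p0f].
pose B m := A (mkseq f m).
have Bi m : internal (B m) := Ai _.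
have Bdec m : elts (B m.+1) `<=` elts (B m).
  by apply: Adec; rewrite mkseqS prefix_rcons.
have tau m : G [set n | upower G n [set c | has_value (chi c) (B m)]].
  by apply/x0tau; exists (theta x0); [exact: thN|exists p0; [exact: p0f|]].
(* The intersection of the B_m is part of the graph of [theta]. *)
have thetaE x y : (forall m, brel (B m) x y) -> y = theta x.
  move=> h; have [p _ hp] := h 0.
  have : graph (internal_maps D) theta p.
    rewrite Agr; exists f => // m _.
    by have [q qB hq] := h m; rewrite (is_pair_uniq hp hq).
  by move=> [x1 _ hp1]; have [-> ->] := is_pair_inj hp hp1.
have [a [aN a_inc UE]] := U_cofinal.
have [UN U_down] := U_cut.
(* Maps differing at two points at most are F_D-equivalent, so the reduction puts the distance of
   their images below some a_n. *)
have [|k step] := @uniform_step W D Di PN B Bi Bdec a aN a_inc.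
  move=> x x' y y' xP x'P yN y'N h tp.
  have [mx mx' _ _] := h 0.
  have : E_cut U (theta x) (theta x').
    by apply/red; [exact: mapS|exact: mapS|exact: F_fin_two].
  have <- : y = theta x by apply: thetaE => m; have [] := h m.
  have <- : y' = theta x' by apply: thetaE => m; have [] := h m.
  move=> [u Uu hu]; have := Uu; rewrite UE => -[n _ un].
  exists n; exists u; first exact: UN.
  by split; [exact/hopE|exact/hrelE].
(* a_k < a_(k+1) puts a_k in U, and s = 2 a_k stays there by additivity. *)
have Ua : U (a k) by rewrite UE; exists k.+1 => //; exact: a_inc.
have [s sN as_] := hadd_ex (aN k).
have Us : U s by exact: U_additive as_.
have [|x [x' [y [y' [[xP x'P yN y'N] h nc [u uN [u1 u2]]]]]]] :=
  @far_pair_limit W D Di PN B Bi Bdec s (ds 0) (ds_D 0) sN.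
  (* A dimension above n in which most vertices have values at level max(n, k). *)
  move=> n; have [N [hN nN]] := ultra_ex GU
    (filterI (tau (maxn n k)) (G_ge n.+1)).
  have [b [c [sb sc ubc _ hbc]]] := upower_cube GU G_ge [::] hN.
  apply: (far_pair_of_cube Bdec ds_inj ds_D chi_map chi_PN chiE (aN k) sN as_ step
    (a := b) (b := c)); rewrite ?sb ?sc //.
have [mx mx' _ _] := h 0.
(* The two maps differ at infinitely many points, yet their images are at distance at most s and so
   E_U-equivalent. *)
apply: (not_F_fin mx mx' nc); apply/red; [exact: mapS|exact: mapS|].
have <- : y = theta x by apply: thetaE => m; have [] := h m.
have <- : y' = theta x' by apply: thetaE => m; have [] := h m.
exists u; last exact/hopE.
by apply: U_down Us _; exact/hrelE.
Qed.
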